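(* Let $f,g\colon X\to\overline{\mathbb{R}}$ be proper functions, $x_0\in X$ and $\varepsilon\ge 0$. Then: (i) $\partial_{c,\varepsilon}f(x_0)\subseteq W$ is e-convex. (ii) For $(x^*,u^*,\alpha)\in W$: $(x^*,u^*,\alpha)\in\partial_{c,\varepsilon}f(x_0)$ if and only if $\langle x_0,u^*\rangle<\alpha$ and $f(x_0)+f^c(x^*,u^*,\alpha)\le c(x_0,(x^*,u^*,\alpha))+\varepsilon$. Moreover, in this case, $x_0\in\partial_{c',\varepsilon}f^c(x^*,u^*,\alpha)$. (iii) If $x_0\in\operatorname{dom}f\cap\operatorname{dom}g$, then $$\bigcup_{\eta\in[0,\varepsilon]}\big(\partial_{c,\eta}f(x_0)+\partial_{c,\varepsilon-\eta}g(x_0)\big)\subseteq\partial_{c,\varepsilon}(f+g)(x_0).$$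
   Context: $X$ is a nontrivial separated (Hausdorff) real locally convex space with continuous dual $X^*$; $X$ carries the topology $\sigma(X,X^* )$ and $X^*$ the topology $\sigma(X^*,X)$; $\langle x,x^*\rangle$ is the value of $x^*\in X^*$ at $x\in X$. $\overline{\mathbb{R}}=\mathbb{R}\cup\{\pm\infty\}$. $W:=X^*\times X^*\times\mathbb{R}$ with the product topology. For an extended-real-valued function $h$, $\operatorname{dom}h=\{h<+\infty\}$; $h$ is proper if it never takes the value $-\infty$ and $\operatorname{dom}h\neq\emptyset$. A subset $C$ of a locally convex space $Y$ is e-convex if for every $y_0\notin C$ there is $y^*\in Y^*$ with $\langle y-y_0,y^*\rangle<0$ for all $y\in C$. Coupling functions: $c(x,(x^*,u^*,\alpha))=c'((x^*,u^*,\alpha),x):=\langle x,x^*\rangle$ if $\langle x,u^*\rangle<\alpha$, and $+\infty$ otherwise. The $c$-conjugate of $f\colon X\to\overline{\mathbb{R}}$ is $f^c\colon W\to\overline{\mathbb{R}}$, $f^c(w):=\sup_{x\in X}\{c(x,w)-f(x)\}$, with the convention $(+\infty)-(+\infty)=-\infty$ inside the supremum. $\varepsilon$-$c$-subdifferential: for $f$ proper with $f(x_0)\in\mathbb{R}$ and $\varepsilon\ge0$, $\partial_{c,\varepsilon}f(x_0)$ is the set of $w=(x^*,u^*,\alpha)\in W$ such that $\langle x_0,u^*\rangle<\alpha$ and $f(x)-f(x_0)\ge c(x,w)-c(x_0,w)-\varepsilon$ for all $x\in X$; if $f(x_0)\notin\mathbb{R}$, $\partial_{c,\varepsilon}f(x_0)=\emptyset$.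 $\varepsilon$-$c'$-subdifferential: for $k\colon W\to\overline{\mathbb{R}}$ proper and $w_0=(x_0^*,u_0^*,\alpha_0)$ with $k(w_0)\in\mathbb{R}$, $\partial_{c',\varepsilon}k(w_0)$ is the set of $x\in X$ such that $\langle x,u_0^*\rangle<\alpha_0$ and $k(w)-k(w_0)\ge c'(w,x)-c'(w_0,x)-\varepsilon$ for all $w\in W$; it is empty if $k(w_0)\notin\mathbb{R}$. Sums of sets are Minkowski sums (the sum with an empty set is empty). *)

(* Defs.v *)
From HB Require Import structures.
From mathcomp Require Import all_boot all_order all_algebra.
From mathcomp Require Import all_classical all_reals all_analysis.
From mathcomp Require Import ring lra.

Set Implicit Arguments.
Unset Strict Implicit.
Unset Printing Implicit Defensive.

Import Order.TTheory GRing.Theory Num.Theory.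
Import numFieldNormedType.Exports.
Local Open Scope classical_set_scope.
Local Open Scope ring_scope.

Section Dual.
Context {R : realType} (X : tvsType R).

Definition lin_cont : {pred X -> R^o} :=
  [pred f : X -> R^o | `[< linear f /\ continuous f >]].

Lemma lin_cont_submod_closed : submod_closed lin_cont.
Proof.
split.
  apply/asboolP; split; first by move=> a x y; rewrite /= scaler0 addr0.
  exact: cst_continuous.
move=> a f g /asboolP[lf cf] /asboolP[lg cg]; apply/asboolP; split.
  move=> b x y.
  change (a * f (b *: x + y) + g (b *: x + y)
    = b * (a * f x + g x) + (a * f y + g y)).
  rewrite lf lg.
  change (a * (b * f x + f y) + (b * g x + g y)
    = b * (a * f x + g x) + (a * f y + g y)).
  by rewrite !mulrDr !mulrA [a * b]mulrC -!addrA; congr +%R; rewrite addrCA.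
move=> x; apply: (@cvgD _ R^o) => //; last exact: cg.
by apply: (@cvgZr _ R^o); exact: cf.
Qed.

HB.instance Definition _ :=
  GRing.isSubmodClosed.Build R (X -> R^o) lin_cont lin_cont_submod_closed.

Record dual := Dual {
  dual_val :> X -> R^o ;
  dualP : dual_val \in lin_cont }.

HB.instance Definition _ := [isSub for dual_val].
HB.instance Definition _ := [Choice of dual by <:].
HB.instance Definition _ := [SubChoice_isSubLmodule of dual by <:].


(* The topology sigma(X^*, X): the coarsest one making all the evaluations
   f |-> f x continuous. *)
HB.instance Definition _ := Topological.copy dual (sup_topology (fun x : X =>
  Topological.class (initial_topology (fun f : dual => f x)))).

Lemma dual_cvgP (F : set_system dual) (f : dual) : Filter F ->
  F --> f <-> forall x, (fun h : dual => h x) @ F --> f x.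
Proof.
move=> FF; split=> [Ff x|Ff].
  have /(_ x) Ffx := (cvg_sup _ _ FF).1 Ff.
  apply: cvg_trans (@initial_continuous _ _ (fun h : dual => h x) f).
  exact: cvg_app.
apply/cvg_sup => x A /=; rewrite (@nbhsE (initial_topology (fun h : dual => h x))) => -[_ [[B oB <-] Bf] BA].
apply: filterS BA _; apply: (Ff x); exact: open_nbhs_nbhs.
Qed.

Lemma dual_add_continuous : continuous (fun p : dual * dual => p.1 + p.2).
Proof.
move=> [f g]; apply/dual_cvgP => x.
have c1 : (fun p : dual * dual => p.1 x) @ (f, g) --> f x.
  exact: (dual_cvgP f _).1 (@cvg_fst _ _ (nbhs f) (nbhs g) _) x.
have c2 : (fun p : dual * dual => p.2 x) @ (f, g) --> g x.
  exact: (dual_cvgP g _).1 (@cvg_snd _ _ (nbhs f) (nbhs g) _) x.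
exact: (@cvgD R R^o _ _ _ _ _ _ _ c1 c2).
Qed.

Lemma dual_scale_continuous : continuous (fun z : R^o * dual => z.1 *: z.2).
Proof.
move=> [a f]; apply/dual_cvgP => x.
have c1 : (fun p : R^o * dual => p.1) @ (a, f) --> a.
  exact: (@cvg_fst _ _ (nbhs a) (nbhs f) _).
have c2 : (fun p : R^o * dual => p.2 x) @ (a, f) --> f x.
  exact: (dual_cvgP f _).1 (@cvg_snd _ _ (nbhs a) (nbhs f) _) x.
exact: (@cvgM R _ _ _ _ _ _ _ c1 c2).
Qed.

Lemma dual_locally_convex : exists2 B : set_system dual,
  (forall b, b \in B -> convex_set b) & basis B.
Proof.
exists [set b | open b /\ convex_set b]; first by move=> b /[!inE] -[].
split; first by move=> b [].
move=> f.
pose G : set_system dual :=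
  filter_from [set b | (open b /\ convex_set b) /\ b f] id.
have FG : Filter G.
  apply: filter_from_filter.
    exists setT => //; split=> //; split; first exact: openT.
    by move=> h k l _ _; rewrite inE.
  move=> b1 b2 [] [op1 c1] b1f [] [op2 c2] b2f; exists (b1 `&` b2) => //.
  split; last by split.
  split; first exact: openI.
  move=> h k l; rewrite !in_setI => /andP[h1 h2] /andP[k1 k2].
  by rewrite c1 ?c2.
have Gf : G --> f.
  apply/dual_cvgP => x; apply/cvgrPdist_lt => e e0.
  exists ((fun h : dual => h x) @^-1` ball (f x) e); last first.
    by move=> h; rewrite /= -ball_normE.
  split; last exact: ballxx.
  split.
    apply: open_comp; last exact: ball_open.
    by move=> h _; exact: (dual_cvgP h (nbhs_filter h)).1.
  move=> h k l; rewrite !inE -!ball_normE /= => hb kb.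
  change (`|f x - (l%:num * h x + (1 - l%:num) * k x)| < e).
  have t0 : 0 <= l%:num :> R by exact: ge0.
  have t1 : 0 <= 1 - l%:num :> R by rewrite subr_ge0; exact: le1.
  move: t0 t1; set t : R := l%:num => t0 t1.
  have -> : f x - (t * h x + (1 - t) * k x)
    = t * (f x - h x) + (1 - t) * (f x - k x) by ring.
  apply: le_lt_trans (ler_normD _ _) _.
  rewrite !normrM (ger0_norm t0) (ger0_norm t1).
  set m := Num.max `|f x - h x| `|f x - k x|.
  have me : m < e by rewrite gt_max hb kb.
  apply: le_lt_trans me.
  have -> : m = t * m + (1 - t) * m by ring.
  by apply: lerD; apply: ler_wpM2l => //; rewrite le_max lexx ?orbT.
move=> U /Gf [b [bP bf] bU]; exists b => //; split => //.
Qed.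

(* This factory only provides the uniform structure; the remaining mixins are
   declared below. *)
HB.instance Definition _ := @PreTopologicalLmod_isTvs.Build R dual
  dual_add_continuous dual_scale_continuous dual_locally_convex.
HB.instance Definition _ :=
  PreTopologicalNmodule_isTopologicalNmodule.Build dual dual_add_continuous.
HB.instance Definition _ :=
  TopologicalNmodule_isTopologicalLmodule.Build R dual dual_scale_continuous.
HB.instance Definition _ := Uniform_isTvs.Build R dual dual_locally_convex.

End Dual.

Definition e_convex {R : realType} {Y : tvsType R} (C : set Y) : Prop :=
  forall y0 : Y, ~ C y0 ->
    exists ys : dual Y, forall y : Y, C y -> ys (y - y0) < 0.

Section ExtendedRealFunctions.
Context {R : realType} {T : Type}.
Implicit Type h : T -> \bar R.
Local Open Scope ereal_scope.

Definition edom h : set T := [set t | h t < +oo].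

Definition proper_efun h : Prop := (forall t, h t != -oo) /\ edom h !=set0.

End ExtendedRealFunctions.

(* The space W = X^* x X^* x R, with the product vector space structure and
   topology; its points are (x^*, u^*, alpha) = (w.1.1, w.1.2, w.2). *)
Definition paramW {R : realType} (X : tvsType R) : tvsType R :=
  Tvs.clone R (dual X * dual X * R^o)%type _.

Section Coupling.
Context {R : realType} {X : tvsType R}.
Implicit Types (x : X) (w : paramW X) (f : X -> \bar R) (k : paramW X -> \bar R)
  (eps : R).
Local Open Scope ereal_scope.

Definition coupling x w : \bar R :=
  if (w.1.2 x < w.2)%R then (w.1.1 x)%:E else +oo.

Definition coupling' w x : \bar R := coupling x w.

(* In \bar R, +oo - +oo = -oo, which is the convention wanted here. *)
Definition c_conj f w : \bar R :=
  ereal_sup [set coupling x w - f x | x in [set: X]].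

(* Both subdifferentials are defined for proper functions only; they are made
   empty for the other ones. *)
Definition c_subdiff eps f x0 : set (paramW X) :=
  [set w : paramW X | [/\ proper_efun f, f x0 \is a fin_num, (w.1.2 x0 < w.2)%R &
    forall x, f x - f x0 >= coupling x w - coupling x0 w - eps%:E]].

Definition c'_subdiff eps k (w0 : paramW X) : set X :=
  [set x : X | [/\ proper_efun k, k w0 \is a fin_num, (w0.1.2 x < w0.2)%R &
    forall w, k w - k w0 >= coupling' w x - coupling' w0 x - eps%:E]].

End Coupling.

Definition minkowski_sum {V : zmodType} (A B : set V) : set V :=
  [set a + b | a in A & b in B].

(* Main.v *)
Require Import Defs.
From mathcomp Require Import all_boot all_order all_algebra.
From mathcomp Require Import all_classical all_reals all_analysis.
From mathcomp Require Import lra.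

Set Implicit Arguments.
Unset Strict Implicit.
Unset Printing Implicit Defensive.

Import Order.TTheory GRing.Theory Num.Theory.
Import numFieldNormedType.Exports.
Local Open Scope classical_set_scope.
Local Open Scope ring_scope.

(* Testing the defining inequality of the eps-c-subdifferential only at the
points where f is finite turns membership of (x*, u*, alpha) into a family of
real inequalities: <x, u*> < alpha and <x - x0, x*> <= f x - f x0 + eps for x
in dom f. Each of them is an open or closed half-space condition on W, and a
point violating one is separated by the corresponding functional
w |-> <x, u*> - alpha or w |-> <x - x0, x*>; taking the supremum over x gives
the characterization by the conjugate, and adding two families gives the sum
rule. *)

Section DualOfW.
Context {R : realType} (X : tvsType R).

Lemma dual_eval_continuous (x : X) : continuous (fun h : dual X => h x : R^o).
Proof. by move=> h; exact: (dual_cvgP h (nbhs_filter h)).1. Qed.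

(** Supplies one of the three kinds of functional from which all separators on [W] are built;
    continuity comes from the projections and the weak-star topology. *)
Lemma evalW1_lin_cont (x : X) :
  (fun w : paramW X => w.1.1 x) \in @lin_cont R (paramW X).
Proof.
apply/asboolP; split=> // w.
apply: (@continuous_comp _ _ _ (fun w : paramW X => w.1.1)
    (fun h : dual X => h x)).
  apply: (@continuous_comp _ _ _ (fun w : paramW X => w.1) fst).
    exact: cvg_fst.
  exact: cvg_fst.
exact: dual_eval_continuous.
Qed.

Lemma evalW2_lin_cont (x : X) :
  (fun w : paramW X => w.1.2 x) \in @lin_cont R (paramW X).
Proof.
apply/asboolP; split=> // w.
apply: (@continuous_comp _ _ _ (fun w : paramW X => w.1.2)
    (fun h : dual X => h x)).
  apply: (@continuous_comp _ _ _ (fun w : paramW X => w.1) snd).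
    exact: cvg_fst.
  exact: cvg_snd.
exact: dual_eval_continuous.
Qed.

Lemma realW_lin_cont : (fun w : paramW X => w.2) \in @lin_cont R (paramW X).
Proof. by apply/asboolP; split=> // w; exact: cvg_snd. Qed.

Definition evalW1 (x : X) : dual (paramW X) := Dual (evalW1_lin_cont x).
Definition evalW2 (x : X) : dual (paramW X) := Dual (evalW2_lin_cont x).
Definition realW : dual (paramW X) := Dual realW_lin_cont.

End DualOfW.

Section FiniteForms.
Context {R : realType} {X : tvsType R}.
Implicit Types (f g : X -> \bar R) (w : paramW X) (x : X).

Lemma proper_fin (T : Type) (h : T -> \bar R) t :
  proper_efun h -> edom h t -> h t \is a fin_num.
Proof. by move=> [/(_ t) hN _] ht; rewrite fin_numE hN -ltey. Qed.

(** Where [f x] is [+oo] the defining inequality is automatic. Where it is finite, a coupling equal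
    to [+oo] would break it, which forces the strict inequality at [x]. *)
Lemma c_subdiffP f x0 eps w : proper_efun f ->
  c_subdiff eps f x0 w <->
  [/\ f x0 \is a fin_num, w.1.2 x0 < w.2 & forall x r, f x = r%:E ->
    w.1.2 x < w.2 /\ w.1.1 x - w.1.1 x0 - eps <= r - fine (f x0)].
Proof.
move=> pf; split=> [[_ f0 w0 H]|[f0 w0 H]]; split=> // x.
  move=> r fx; have := H x; rewrite /coupling w0 fx -(fineK f0).
  by case: ifP.
rewrite /coupling w0 -(fineK f0).
case fx : (f x) => [r| |].
- by have [-> ] := H _ _ fx; rewrite -!EFinD lee_fin.
- exact: leey.
- by case: pf => /(_ x); rewrite fx.
Qed.

(** Only [dom f] matters: if [f x] is [+oo], the term of the supremum is [-oo], even when the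
    coupling is [+oo]. *)
Lemma c_conj_leP f w (b : R) : proper_efun f ->
  (c_conj f w <= b%:E)%E <->
  forall x r, f x = r%:E -> w.1.2 x < w.2 /\ w.1.1 x - r <= b.
Proof.
move=> pf; split=> [H x r fx|H].
  have : (coupling x w - f x <= b%:E)%E.
    by apply: le_trans H; apply: ereal_sup_ubound; exists x.
  by rewrite /coupling fx; case: ifP.
apply: ge_ereal_sup => _ [x _ <-].
case fx : (f x) => [r| |].
- by rewrite /coupling; have [-> ?] := H _ _ fx; rewrite -EFinB lee_fin.
- by rewrite addeNy leNye.
- by case: pf => /(_ x); rewrite fx.
Qed.

Lemma c_conj_neqNy f w : proper_efun f -> c_conj f w != -oo%E.
Proof.
move=> pf; have [x /(proper_fin pf) fx] := pf.2.
rewrite -ltNye; apply: (@lt_le_trans _ _ (coupling x w - f x)%E).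
  by rewrite /coupling -(fineK fx); case: ifP => _; rewrite ltNye.
by apply: ereal_sup_ubound; exists x.
Qed.

Lemma c_subdiff_conjP f x0 eps w : proper_efun f ->
  c_subdiff eps f x0 w <->
  [/\ f x0 \is a fin_num, w.1.2 x0 < w.2 &
    (c_conj f w <= (w.1.1 x0 + eps - fine (f x0))%:E)%E].
Proof.
move=> pf; rewrite (c_subdiffP _ _ _ pf).
split=> -[f0 w0 H]; split=> //.
  by apply/c_conj_leP => // x r /H [? ?]; split=> //; lra.
by move=> x r /((c_conj_leP _ _ pf).1 H) [? ?]; split=> //; lra.
Qed.

Lemma proper_efunD f g x : proper_efun f -> proper_efun g ->
  edom f x -> edom g x -> proper_efun (fun y => f y + g y)%E.
Proof.
move=> pf pg fx gx; split=> [t|].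
  by rewrite adde_eq_ninfty negb_or pf.1 pg.1.
by exists x; rewrite /edom /= lte_add_pinfty.
Qed.

Lemma e_convex_c_subdiff f x0 eps : proper_efun f ->
  e_convex (c_subdiff eps f x0).
Proof.
move=> pf w0 nw0.
have [f0|nf0] := boolP (f x0 \is a fin_num); last first.
  (* The subdifferential is empty here, so any functional separates. *)
  by exists 0 => w /(c_subdiffP _ _ _ pf) [f0]; rewrite f0 in nf0.
have [u0|u0] := ltP (w0.1.2 x0) w0.2; last first.
  (* This functional is negative on the subdifferential and nonnegative at [w0]. *)
  exists (evalW2 x0 - realW X) => w /(c_subdiffP _ _ _ pf) [_ uw _].
  change (w.1.2 x0 - w0.1.2 x0 - (w.2 - w0.2) < 0); lra.
have /existsNP [x /existsNP [r /not_implyP [fx nH]]] :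
    ~ forall x r, f x = r%:E ->
    w0.1.2 x < w0.2 /\ w0.1.1 x - w0.1.1 x0 - eps <= r - fine (f x0).
  by move=> H; apply: nw0; apply/c_subdiffP.
(* At [x], the point [w0] violates either the slope bound or the strict inequality; the violated one
   selects the functional. *)
have [u1|u1] := ltP (w0.1.2 x) w0.2.
  exists (evalW1 x - evalW1 x0) => w /(c_subdiffP _ _ _ pf)
    [_ _ /(_ x r fx) [_ H]].
  change ((w.1.1 x - w0.1.1 x) - (w.1.1 x0 - w0.1.1 x0) < 0).
  have : r - fine (f x0) < w0.1.1 x - w0.1.1 x0 - eps.
    by rewrite ltNge; apply/negP => ?; apply: nH.
  lra.
exists (evalW2 x - realW X) => w /(c_subdiffP _ _ _ pf) [_ _ /(_ x r fx) [H _]].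
change (w.1.2 x - w0.1.2 x - (w.2 - w0.2) < 0); lra.
Qed.

Lemma c_subdiff_FenchelP f x0 eps w : proper_efun f ->
  c_subdiff eps f x0 w <->
  w.1.2 x0 < w.2 /\ (f x0 + c_conj f w <= coupling x0 w + eps%:E)%E.
Proof.
move=> pf; rewrite (c_subdiff_conjP _ _ _ pf) /coupling; split.
  move=> [f0 w0 H]; split=> //; rewrite w0 -leeBrDl // -[in leRHS](fineK f0).
  by rewrite -EFinD.
move=> [w0]; rewrite w0 => H.
(* Were [f x0] equal to [+oo], the left side of [H] would be [+oo], since the conjugate is never
   [-oo], while the right side is real. *)
have f0 : f x0 \is a fin_num.
  apply: proper_fin => //; rewrite /edom /= ltey; apply/eqP => fy.
  by move: H; rewrite fy addye ?c_conj_neqNy.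
split=> //; move: H; rewrite -leeBrDl // -[in leRHS](fineK f0).
by rewrite -EFinD.
Qed.

(** Young's inequality at [(x0, v)] bounds [c_conj f v] from below, and the characterization by the
    conjugate bounds [c_conj f w] from above; subtract. *)
Lemma c_subdiff_c'_subdiff f x0 eps w :
  c_subdiff eps f x0 w -> c'_subdiff eps (c_conj f) w x0.
Proof.
move=> sw; have [pf _ _ _] := sw.
have [f0 w0 H] := (c_subdiff_conjP _ _ _ pf).1 sw.
have cw : edom (c_conj f) w by apply: le_lt_trans H _; exact: ltry.
have pc : proper_efun (c_conj f).
  by split; [move=> ?; exact: c_conj_neqNy|exists w].
have cf := proper_fin pc cw.
split=> // v; rewrite /coupling' {2}/coupling w0.
move: H; rewrite -(fineK cf) lee_fin => H.
have : (coupling x0 v - f x0 <= c_conj f v)%E.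
  by apply: ereal_sup_ubound; exists x0.
rewrite -(fineK f0) /coupling; case: ifP => _.
  case: (c_conj f v) => [r| |] //.
    by rewrite -!EFinB !lee_fin => ?; lra.
  by move=> _; rewrite addye // leey.
(* With coupling [+oo] at [v], Young's inequality forces [c_conj f v] to be [+oo]. *)
by rewrite addye // leye_eq => /eqP ->; rewrite leey.
Qed.

Lemma c_subdiffD f g x0 eta eps : proper_efun f -> proper_efun g ->
  minkowski_sum (c_subdiff eta f x0) (c_subdiff (eps - eta) g x0)
    `<=` c_subdiff eps (fun x => f x + g x)%E x0.
Proof.
move=> pf pg w [a /(c_subdiffP _ _ _ pf) [f0 a0 Ha]
    [b /(c_subdiffP _ _ _ pg) [g0 b0 Hb] <-]].
have pfg : proper_efun (fun x => f x + g x)%E.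
  by apply: (@proper_efunD _ _ x0); rewrite /edom //= ltey_eq ?f0 ?g0.
apply/c_subdiffP => //; split.
- by rewrite fin_numD f0.
- by change (a.1.2 x0 + b.1.2 x0 < a.2 + b.2); lra.
- move=> x r fgx.
  change (a.1.2 x + b.1.2 x < a.2 + b.2 /\
    a.1.1 x + b.1.1 x - (a.1.1 x0 + b.1.1 x0) - eps <= r - fine (f x0 + g x0)%E).
  (* A finite sum has finite summands, so both families of inequalities apply at [x]; adding them
     turns the errors [eta] and [eps - eta] into [eps]. *)
  have : (f x + g x)%E \is a fin_num by rewrite fgx.
  rewrite fin_numD => /andP[fx gx].
  have [? ?] := Ha x _ (esym (fineK fx)); have [? ?] := Hb x _ (esym (fineK gx)).
  have -> : r = fine (f x) + fine (g x) by rewrite -fineD // fgx.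
  by rewrite fineD //; split; lra.
Qed.

End FiniteForms.

Theorem theorem3p8 (R : realType) (X : tvsType R)
    (X_hausdorff : hausdorff_space X) (X_nontrivial : exists x : X, x != 0)
    (f g : X -> \bar R) (f_proper : proper_efun f) (g_proper : proper_efun g)
    (x0 : X) (eps : R) (eps_ge0 : 0 <= eps) :
  [/\ e_convex (c_subdiff eps f x0),
      forall (xs us : dual X) (alpha : R),
        (c_subdiff eps f x0 (xs, us, alpha) <->
          us x0 < alpha /\
          (f x0 + c_conj f (xs, us, alpha)
             <= coupling x0 (xs, us, alpha) + eps%:E)%E) /\
        (c_subdiff eps f x0 (xs, us, alpha) ->
          c'_subdiff eps (c_conj f) (xs, us, alpha) x0)
    & x0 \in edom f `&` edom g ->
      \bigcup_(eta in `[0, eps])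
        minkowski_sum (c_subdiff eta f x0) (c_subdiff (eps - eta) g x0)
      `<=` c_subdiff eps (fun x => f x + g x)%E x0].
Proof.
split.
- exact: e_convex_c_subdiff.
- move=> xs us alpha; split; first exact: c_subdiff_FenchelP.
  exact: c_subdiff_c'_subdiff.
- by move=> _ w [eta _]; exact: c_subdiffD.
Qed.
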